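(* Consider the urn model with transition matrix $M=\bigl(\begin{smallmatrix}-1&0\\1&-2\end{smallmatrix}\bigr)$, and let $X_{n,2m}$ denote the number of white balls in the urn at the moment when the black balls are all removed, starting with $2m$ black balls and $n$ white balls ($m\ge 1$, $n\ge 0$ integers). Then: (i) If $m\to\infty$ (with $n=n(m)\ge 0$ an arbitrary sequence of integers), then $$\frac{X_{n,2m}}{\frac{n}{\sqrt m}+2\sqrt m}\xrightarrow{(d)}R,$$ where $R$ is a Rayleigh random variable with density $2x e^{-x^{2}}$, $x\ge 0$. (ii) If $m$ is fixed and $n\to\infty$, then $$\frac{X_{n,2m}}{n}\xrightarrow{(d)}B_{2m},$$ where $B_{2m}$ is distributed as the square root of a $\mathrm{Beta}(1,m)$ random variable, i.e. has density $2mx(1-x^{2})^{m-1}$, $0\le x\le 1$.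
   Context: Urn process: the urn contains black and white balls. At every step a ball is drawn uniformly at random from the urn, its color is observed and it is put back. With the transition matrix $\bigl(\begin{smallmatrix}-1&0\\1&-2\end{smallmatrix}\bigr)$: if the urn has $\tilde m$ black and $n$ white balls, then with probability $\frac{n}{n+\tilde m}$ (white ball drawn) one white ball is removed, giving $\tilde m$ black and $n-1$ white balls; with probability $\frac{\tilde m}{n+\tilde m}$ (black ball drawn) one white ball is added and two black balls are removed, giving $\tilde m-2$ black and $n+1$ white balls. The process starts with an even number $2m$ of black balls and stops when the number of black balls is $0$. The symbol $\xrightarrow{(d)}$ denotes convergence in distribution. *)

(* Defs.v *)
From HB Require Import structures.
From mathcomp Require Import all_boot all_order all_algebra.
From mathcomp Require Import all_classical all_reals all_analysis.
Set Implicit Arguments.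
Unset Strict Implicit.
Unset Printing Implicit Defensive.
Import Order.TTheory GRing.Theory Num.Theory.
Import numFieldNormedType.Exports.
Local Open Scope classical_set_scope.
Local Open Scope ring_scope.

Definition white : 'I_2 := ord0.
Definition black : 'I_2 := ord_max.

(* An urn content is a row vector (number of white balls, number of black
   balls).  Row c of M is added to it when a ball of color c is drawn; counts
   are integers so that this is a genuine addition. *)
Definition urn_content (M : 'M[int]_2) (v : 'rV[int]_2) (h : seq 'I_2) :
    'rV[int]_2 :=
  foldl (fun u c => u + row c M) v h.

(* No moment up to the end of the color history h, both ends included, has an
   urn without black balls. *)
Definition urn_running (M : 'M[int]_2) (v : 'rV[int]_2) (h : seq 'I_2) : Prop :=
  forall k, (k <= size h)%N -> urn_content M v (take k h) 0 black != 0.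

Definition draw_prob (R : realType) (u : 'rV[int]_2) (c : 'I_2) : R :=
  (u 0 c)%:~R / (u 0 white + u 0 black)%:~R.

Definition history (T : Type) (C : nat -> T -> 'I_2) (t : nat) (w : T) :
    seq 'I_2 :=
  mkseq (fun i => C i w) t.

(* C i is the color of the (i+1)-st ball drawn from the urn with matrix M
   started at v: as long as black balls remain, the next color given the whole
   past is that of a ball drawn uniformly from the current content.  Nothing is
   required of the draws after the process has stopped. *)
Definition urn_draws (R : realType) (d : measure_display) (T : measurableType d)
    (P : probability T R) (M : 'M[int]_2) (v : 'rV[int]_2)
    (C : nat -> T -> 'I_2) : Prop :=
  (forall i c, measurable [set w | C i w = c]) /\
  forall (h : seq 'I_2) (c : 'I_2), urn_running M v h ->
    P [set w | history C (size h).+1 w = rcons h c] =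
    (P [set w | history C (size h) w = h]
      * (draw_prob R (urn_content M v h) c)%:E)%E.

Definition urn_stops_at (T : Type) (M : 'M[int]_2) (v : 'rV[int]_2)
    (C : nat -> T -> 'I_2) (w : T) (t : nat) : Prop :=
  urn_content M v (history C t w) 0 black = 0 /\
  forall s, (s < t)%N -> urn_content M v (history C s w) 0 black != 0.

(* X is the number of white balls at the first moment without black balls.
   Where that moment does not exist (a null event for the urn considered here)
   X is arbitrary. *)
Definition final_white (R : realType) (T : Type) (M : 'M[int]_2)
    (v : 'rV[int]_2) (C : nat -> T -> 'I_2) (X : T -> R) : Prop :=
  forall w t, urn_stops_at M v C w t ->
    X w = (urn_content M v (history C t w) 0 white)%:~R.

Definition urnM : 'M[int]_2 :=
  \matrix_(i < 2, j < 2)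
    if i == white then (if j == white then -1 else 0)
    else (if j == white then 1 else - 2).

Definition urn_init (n b : nat) : 'rV[int]_2 :=
  \row_(j < 2) if j == white then n%:Z else b%:Z.

(* Convergence in distribution of real random variables, possibly all on
   different probability spaces: the distribution functions converge at every
   continuity point of the limiting one. *)
Definition cvg_in_distribution (R : realType)
    (d : nat -> measure_display) (T : forall k, measurableType (d k))
    (P : forall k, probability (T k) R) (Y : forall k, {RV (P k) >-> R})
    (d' : measure_display) (T' : measurableType d') (Q : probability T' R)
    (Z : {RV Q >-> R}) : Prop :=
  forall x : R, {for x, continuous (cdf Z)} ->
    cdf (Y k) x @[k --> \oo] --> cdf Z x.

Definition has_density (R : realType) (d : measure_display)
    (T : measurableType d) (P : probability T R) (X : {RV P >-> R})
    (f : R -> R) : Prop :=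
  forall A : set R, measurable A ->
    distribution P X A = (\int[lebesgue_measure]_(x in A) (f x)%:E)%E.

Definition rayleigh_density (R : realType) (x : R) : R :=
  if 0 <= x then 2 * x * expR (- x ^+ 2) else 0.

Definition sqrt_beta_density (R : realType) (m : nat) (x : R) : R :=
  if 0 <= x <= 1 then (2 * m)%:R * x * (1 - x ^+ 2) ^+ m.-1 else 0.

(* Main.v *)
Require Import Defs.
From HB Require Import structures.
From mathcomp Require Import all_boot all_order all_algebra.
From mathcomp Require Import all_classical all_reals all_analysis.
From mathcomp Require Import measurable_realfun.
From mathcomp Require Import ring lra zify.
Set Implicit Arguments.
Unset Strict Implicit.
Unset Printing Implicit Defensive.
Import Order.TTheory GRing.Theory Num.Theory.
Import numFieldNormedType.Exports.
Local Open Scope classical_set_scope.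
Local Open Scope ring_scope.

(** Put the urn in continuous time: every ball gets an exponential clock of
    rate 1 and is the ball drawn when its clock rings.  A white ball then dies
    at rate 1; group the black balls into m pairs, and each pair turns into one
    white ball at rate 2.  All these particles are independent, and the urn is
    the jump chain of the system.  It stops at the time tau at which the last
    pair converts.  With U = exp(-tau) one has
    P(U > x) = P(tau < - ln x) = (1 - x^2)^m on [0, 1], so U is the square
    root of a Beta(1, m) variable.
    Given U = u, each initial white ball is alive with probability u, each of
    the m - 1 other pairs is present as a living white ball with probability
    2u/(1+u), and the last pair has just produced a white ball.  Hence X is
    distributed as 1 + Bin(n, U) + Bin(m-1, 2U/(1+U)).

    Given U = u this sum concentrates: around nu if m is fixed and n grows,
    and around (n + 2m)u if m grows, because U is then of order 1/sqrt m.
    Since n/sqrt m + 2 sqrt m = (n + 2m)/sqrt m, the normalised variable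
    follows U in the first case and sqrt m * U in the second, and
    P(sqrt m * U > y) = (1 - y^2/m)^m tends to exp(-y^2).

    The particle system only suggests the formula.  The proof integrates the
    conditional generating function of X against the density of U and checks
    that the outcome solves the first-step recursion of the urn
    ([mix_law_rec]); the defect of the recursion is an exact derivative in the
    mixing variable.  Following the draws one by one identifies the law of X
    with this mixture ([urn_law_history]).  Chebyshev's inequality inside the
    mixture then squeezes the distribution function of X between shifts of
    that of U ([mix_cdf_le], [mix_cdf_ge]), with a quantitative error in
    either regime ([mix_cdf_bounds_grow], [mix_cdf_bounds_fixed]), and
    [cvg_of_perturbation] turns such bounds into convergence.

    The joint density of X and U is polynomial in u, since the factor
    (1 - u^2)^(m-1) in the density of U clears the denominators 1 + u.  All
    integrals over U are therefore integrals of polynomials. *)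

(** * Integrals of polynomials *)

Section PolyIntegral.
Variable R : realType.
Implicit Types (p q : {poly R}) (a b : R).

(** The constant term is p_0 / 0 = 0, which normalises the primitive. *)
Definition prim p : {poly R} := \poly_(i < (size p).+1) (p`_i.-1 / i%:R).

Lemma coef_prim p i : (prim p)`_i = p`_i.-1 / i%:R.
Proof.
rewrite coef_poly; case: ltnP => // pi.
by case: i pi => // i pi; rewrite nth_default // mul0r.
Qed.

Lemma deriv_prim p : (prim p)^`() = p.
Proof.
apply/polyP => i; rewrite coef_deriv coef_prim /= -[LHS]mulr_natr.
by rewrite divfK // pnatr_eq0.
Qed.

Lemma prim_deriv p : prim p^`() = p - (p`_0)%:P.
Proof.
apply/polyP => -[|i]; rewrite coef_prim coefB coefC /=.
  by rewrite invr0 mulr0 subrr.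
by rewrite coef_deriv -[X in X / _]mulr_natr mulfK ?pnatr_eq0// subr0.
Qed.

(** Defined through the primitive so that linearity, Chasles' relation and the
    integral of a derivative are plain algebra; order enters only in
    [pint_ge0]. *)
Definition pint a b p : R := (prim p).[b] - (prim p).[a].

Lemma prim_is_linear : linear prim.
Proof.
move=> c p q; apply/polyP => i.
by rewrite coefD coefZ !coef_prim coefD coefZ mulrDl mulrA.
Qed.

Lemma pint_is_linear a b : linear (pint a b : {poly R} -> R^o).
Proof.
move=> c p q; rewrite /pint prim_is_linear !hornerD !hornerZ /GRing.scale /=.
by ring.
Qed.

HB.instance Definition _ a b :=
  GRing.isLinear.Build R {poly R} R^o _ (pint a b) (@pint_is_linear a b).

Lemma pintZ a b c p : pint a b (c *: p) = c * pint a b p.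
Proof. exact: linearZZ. Qed.

Lemma pint_deriv a b p : pint a b p^`() = p.[b] - p.[a].
Proof. by rewrite /pint prim_deriv !hornerE; ring. Qed.

Lemma pint_cut a b c p : pint a c p = pint a b p + pint b c p.
Proof. by rewrite /pint; ring. Qed.

Lemma pint_ge0 a b p : a <= b ->
  (forall u, a <= u <= b -> 0 <= p.[u]) -> 0 <= pint a b p.
Proof.
move=> ab p0; rewrite subr_ge0.
apply: (@ger0_derive1_ndecr R (horner (prim p)) a b) => //.
- move=> x; rewrite in_itv /= => /andP[ax xb].
  by rewrite -derivE deriv_prim p0// !ltW.
- by apply: continuous_subspaceT; exact: continuous_horner.
Qed.

Lemma pint_le a b p q : a <= b ->
  (forall u, a <= u <= b -> p.[u] <= q.[u]) -> pint a b p <= pint a b q.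
Proof.
move=> ab pq; rewrite -subr_ge0 -raddfB; apply: pint_ge0 => // u uab.
by rewrite hornerD hornerN subr_ge0 pq.
Qed.

End PolyIntegral.

(** * Expectations read off generating functions *)

Section Expectation.
Variable R : realType.
Implicit Types (g : nat -> R) (q : {poly R}).

(** E[g(K)] for a random integer K with generating function q.  It makes sense
    for every q, normalised or not, and is linear in q; this is what allows it
    to be applied to the coefficients of a polynomial in another variable. *)
Definition pgfE g q : R := \sum_(k < size q) q`_k * g k.

Lemma pgfE_widen N g q : (size q <= N)%N ->
  pgfE g q = \sum_(k < N) q`_k * g k.
Proof.
move=> qN; rewrite /pgfE (big_ord_widen _ (fun k => q`_k * g k) qN).
rewrite big_mkcond; apply: eq_bigr => k _; case: ltnP => // qk.
by rewrite nth_default // mul0r.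
Qed.

Lemma pgfE_is_linear g : linear (pgfE g : {poly R} -> R^o).
Proof.
move=> c p q; set N := maxn (size p) (size q).
have pN : (size p <= N)%N by exact: leq_maxl.
have qN : (size q <= N)%N by exact: leq_maxr.
have cN : (size (c *: p + q)%R <= N)%N.
  rewrite (leq_trans (size_polyD _ _)) // geq_max qN andbT.
  exact: leq_trans (size_scale_leq _ _) pN.
rewrite (pgfE_widen g pN) (pgfE_widen g qN) (pgfE_widen g cN).
rewrite scaler_sumr -big_split; apply: eq_bigr => k _ /=.
by rewrite coefD coefZ /GRing.scale /=; ring.
Qed.

HB.instance Definition _ g :=
  GRing.isLinear.Build R {poly R} R^o _ (pgfE g) (pgfE_is_linear g).

Lemma pgfEZ g c q : pgfE g (c *: q) = c * pgfE g q.
Proof. exact: linearZZ. Qed.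

Lemma pgfE1 g : pgfE g 1 = g 0%N.
Proof. by rewrite /pgfE size_poly1 big_ord1 coef1 mul1r. Qed.

Lemma pgfE_mulX g q : pgfE g ('X * q) = pgfE (fun k => g k.+1) q.
Proof.
have s : (size ('X * q)%R <= (size q).+1)%N.
  by rewrite (leq_trans (size_polyMleq _ _)) // size_polyX.
rewrite (pgfE_widen g s) big_ord_recl coefXM mul0r add0r.
by apply: eq_bigr => k _; rewrite coefXM.
Qed.

Lemma pgfEX g n : pgfE g 'X^n = g n.
Proof.
elim: n g => [|n IH] g; first by rewrite expr0 pgfE1.
by rewrite exprS pgfE_mulX IH.
Qed.

Lemma eq_pgfE g g' q : g =1 g' -> pgfE g q = pgfE g' q.
Proof. by move=> e; apply: eq_bigr => k _; rewrite e. Qed.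

Lemma pgfE_le g g' q : (forall k, 0 <= q`_k) ->
  (forall k, g k <= g' k) -> pgfE g q <= pgfE g' q.
Proof.
move=> q0 gg'; apply: ler_sum => k _.
by rewrite ler_wpM2l.
Qed.

(** The generating function of a Bernoulli(p) variable. *)
Definition bern (p : R) : {poly R} := (1 - p)%:P + p *: 'X.

Lemma coef_bernX_ge0 n p q : 0 <= p <= 1 -> (forall k, 0 <= q`_k) ->
  forall k, 0 <= (bern p ^+ n * q)`_k.
Proof.
move=> /andP[p0 p1] q0; elim: n => [|n IH] k; first by rewrite expr0 mul1r.
rewrite exprS -mulrA mulrDl mul_polyC -scalerAl coefD !coefZ coefXM.
by rewrite addr_ge0 ?mulr_ge0 ?subr_ge0//; case: ifP.
Qed.

Lemma pgfE_bern g p q :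
  pgfE g (bern p * q) = (1 - p) * pgfE g q + p * pgfE (fun k => g k.+1) q.
Proof.
rewrite mulrDl raddfD /= mul_polyC pgfEZ -scalerAl pgfEZ.
by rewrite pgfE_mulX.
Qed.

Lemma pgfED g g' q : pgfE (fun k => g k + g' k) q = pgfE g q + pgfE g' q.
Proof. by rewrite -big_split; apply: eq_bigr => k _; rewrite mulrDr. Qed.

Lemma pgfEMl c g q : pgfE (fun k => c * g k) q = c * pgfE g q.
Proof.
by rewrite /pgfE mulr_sumr; apply: eq_bigr => k _; rewrite mulrCA.
Qed.

(** An independent Bernoulli(p) summand moves the centre by p and adds p(1-p)
    to the mean square, so the functions c + s(k - a)^2 are stable under the
    induction. *)
Lemma pgfE_sqr_bernX n (p a c s : R) q :
  pgfE (fun k => c + s * (k%:R - a) ^+ 2) (bern p ^+ n * q) =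
  pgfE (fun k => c + s * (n%:R * p * (1 - p))
                   + s * (k%:R - (a - n%:R * p)) ^+ 2) q.
Proof.
elim: n a c => [|n IH] a c.
  by rewrite expr0 mul1r; apply: eq_pgfE => k; ring.
rewrite exprS -mulrA pgfE_bern.
rewrite (eq_pgfE (g := fun k => _ + _ * (k.+1%:R - a) ^+ 2)
  (g' := fun k => c + s * (k%:R - (a - 1)) ^+ 2)); last first.
  by move=> k; rewrite -natr1; ring.
rewrite !IH -!pgfEMl -pgfED; apply: eq_pgfE => k.
by rewrite -natr1; ring.
Qed.

End Expectation.

(** * The mixture and the first-step recursion *)

Section Mixture.
Variable R : realType.
Implicit Types (g : nat -> R).

Local Notation RZ := {poly R}.
Local Notation z := (('X : RZ)%:P : {poly RZ}).
Local Notation x := ('X : {poly RZ}).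

(* x stands for exp(-t): A is the generating function of an initial white
   ball at time t, and B that of a pair on the event that it has converted. *)
Let A : {poly RZ} := 1 - x + x * z.
Let B : {poly RZ} := (1 - x) * (1 - x + 2 * x * z).

(** The density of U at x times the generating function of X given U = x.  The
    mixing variable is the outer one, so that differentiation in x is [deriv]
    and the variable z that counts white balls is a constant. *)
Definition mix_pgf n m : {poly RZ} :=
  (2 * m)%:R * x * z * A ^+ n * B ^+ m.-1.

(** x times [mix_pgf], that is the same density in the variable t = - ln x, in
    which the particles evolve. *)
Definition mix_prim n m : {poly RZ} :=
  (2 * m)%:R * x ^+ 2 * z * A ^+ n * B ^+ m.-1.

Lemma deriv_nat k : (k%:R : {poly RZ})^`() = 0.
Proof. by rewrite -polyC_natr derivC. Qed.

(** The particle dynamics are the two relations x A' = A - 1 (a white ball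
    dies) and x B' = 2 (B - A) (a pair becomes a white ball); the second holds
    because B = A^2 - (xz)^2.  Expanding the derivative of the product with
    them gives the recursion of the urn. *)
Lemma mix_pgf_rec n m :
  (n + 2 * m.+2)%:R * mix_pgf n m.+2 =
  (mix_prim n m.+2)^`() + n%:R * mix_pgf n.-1 m.+2
    + (2 * m.+2)%:R * mix_pgf n.+1 m.+1.
Proof.
have dA : (A ^+ n)^`() = n%:R * (z - 1) * A ^+ n.-1.
  by rewrite deriv_exp -mulr_natl mulrA /A !poly.derivE; ring.
have dB : (B ^+ m.+1)^`() =
    m.+1%:R * (2 * A * (z - 1) - 2 * x * z ^+ 2) * B ^+ m.
  rewrite deriv_exp -mulr_natl mulrA /B /A -(polyC_natr RZ 2) !poly.derivE.
  by ring.
rewrite /mix_pgf /mix_prim !derivM deriv_nat derivC derivX dA dB.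
rewrite /= !exprS; set Q := B ^+ m.
case: n {dA} => [|n] /=; first by rewrite expr0 /B /A; ring.
by rewrite exprS; set P := A ^+ n; rewrite /B /A; ring.
Qed.

(** With a single pair, its conversion ends the process: the third term of
    [mix_pgf_rec] is gone and will reappear as a boundary value. *)
Lemma mix_pgf_rec1 n :
  (n + 2)%:R * mix_pgf n 1 = (mix_prim n 1)^`() + n%:R * mix_pgf n.-1 1.
Proof.
have dA : (A ^+ n)^`() = n%:R * (z - 1) * A ^+ n.-1.
  by rewrite deriv_exp -mulr_natl mulrA /A !poly.derivE; ring.
rewrite /mix_pgf /mix_prim !derivM deriv_nat derivC derivX dA.
rewrite /= !expr0 -polyC1 derivC.
case: n {dA} => [|n] /=; first by rewrite expr0 /A; ring.
by rewrite exprS; set P := A ^+ n; rewrite /A; ring.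
Qed.

Lemma horner_map_pgfE g (q : {poly RZ}) u :
  (map_poly (pgfE g) q).[u] = pgfE g q.[u%:P].
Proof.
rewrite (horner_coef_wide _ (size_poly _ _)) horner_coef raddf_sum /=.
apply: eq_bigr => i _.
rewrite coef_map_id0 ?raddf0// -polyC_exp [in RHS]mulrC mul_polyC pgfEZ.
by rewrite mulrC.
Qed.

Lemma map_pgfE_deriv g (q : {poly RZ}) :
  map_poly (pgfE g) q^`() = (map_poly (pgfE g) q)^`().
Proof.
apply/polyP => i; rewrite coef_map_id0 ?raddf0// !coef_deriv.
by rewrite coef_map_id0 ?raddf0// raddfMn.
Qed.

Lemma hornerA (u : R) : A.[u%:P] = bern u.
Proof.
rewrite /A /bern !hornerE polyCB -mul_polyC; ring.
Qed.

Lemma hornerB (u : R) : 0 <= u ->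
  B.[u%:P] = (1 - u ^+ 2) *: bern (2 * u / (1 + u)).
Proof.
move=> u0; have u1 : 1 + u != 0 by rewrite gt_eqF// ltr_pwDl.
rewrite /B /bern -(polyC_natr RZ 2) !hornerE scalerDr scalerA.
rewrite -mul_polyC -polyCM.
have -> : (1 - u ^+ 2) * (1 - 2 * u / (1 + u)) = (1 - u) ^+ 2 by field.
have -> : (1 - u ^+ 2) * (2 * u / (1 + u)) = (1 - u) * (2 * u) by field.
rewrite -mul_polyC; ring.
Qed.

(** This is where the mixture is seen: at u the factor B is 1 - u^2, the
    probability that a pair has converted, times a Bernoulli(2u/(1+u))
    generating function. *)
Lemma horner_mix_pgf n m (u : R) : 0 <= u -> (mix_pgf n m).[u%:P] =
  ((2 * m)%:R * u * (1 - u ^+ 2) ^+ m.-1) *: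
    (bern u ^+ n * (bern (2 * u / (1 + u)) ^+ m.-1 * 'X)).
Proof.
move=> u0; rewrite /mix_pgf -polyC_natr.
have := hornerB u0; have := hornerA u; move: (A) (B) => a b hA hB.
rewrite !(hornerM, horner_exp, hornerC, hornerX) hA hB exprZn -!mul_polyC.
by rewrite polyCM; ring.
Qed.

Lemma horner_mix_prim n m (u : R) : (mix_prim n m).[u%:P] =
  (2 * m)%:R * (u ^+ 2)%:P * 'X * bern u ^+ n * B.[u%:P] ^+ m.-1.
Proof.
rewrite /mix_prim -polyC_natr; have := hornerA u; move: (A) (B) => a b hA.
by rewrite !(hornerM, horner_exp, hornerC, hornerX) hA; ring.
Qed.

(** E[g(X)] as the mixture predicts it, started from n white balls and m
    pairs. *)
Definition mix_law g n m : R :=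
  if m is 0 then g n else pint 0 1 (map_poly (pgfE g) (mix_pgf n m)).

Let pE g q := pint 0 1 (map_poly (pgfE g) q).

Let pE_nat g k (q : {poly RZ}) : pE g (k%:R * q) = k%:R * pE g q.
Proof. by rewrite /pE mulr_natl !raddfMn mulr_natl. Qed.

Let pE_D g p q : pE g (p + q) = pE g p + pE g q.
Proof. by rewrite /pE !raddfD. Qed.

Let pE_deriv g q : pE g q^`() = pgfE g q.[1] - pgfE g q.[0].
Proof.
by rewrite /pE map_pgfE_deriv pint_deriv !horner_map_pgfE polyC1 polyC0.
Qed.

Let mix_prim0 n m : (mix_prim n m).[0] = 0.
Proof. by rewrite -polyC0 horner_mix_prim !expr0n/=; ring. Qed.

Let B1 : B.[1] = 0.
Proof. by rewrite -polyC1 hornerB// expr1n subrr scale0r. Qed.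

(** Integrating the derivative in [mix_pgf_rec] leaves a boundary value at
    x = 1, that is at time 0.  It vanishes when there are at least two pairs,
    since then B(1) = 0; for one pair it is 2 z^(n+1), the contribution of the
    urn that stops at once with n + 1 white balls. *)
Lemma mix_law_rec g n m : (0 < m)%N ->
  (n + 2 * m)%:R * mix_law g n m =
  n%:R * mix_law g n.-1 m + (2 * m)%:R * mix_law g n.+1 m.-1.
Proof.
case: m => // -[|m] _; rewrite /mix_law -?/(pE g _) -!pE_nat.
  rewrite mix_pgf_rec1 pE_D pE_deriv mix_prim0 raddf0 subr0 addrC.
  congr (_ + _); rewrite -polyC1 horner_mix_prim muln1 expr0 mulr1 expr1n.
  rewrite polyC1 mulr1 /bern subrr polyC0 add0r scale1r -mulrA -exprS.
  by rewrite mulr_natl raddfMn mulr_natl/= pgfEX.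
rewrite mix_pgf_rec !pE_D pE_deriv mix_prim0 raddf0 subr0.
by rewrite -polyC1 horner_mix_prim polyC1 B1 /= expr0n mulr0 raddf0 add0r.
Qed.

End Mixture.

(** * Concentration inside the mixture *)

Section Concentration.
Variable R : realType.
Implicit Types (g : nat -> R) (V : {poly R}).

(** The density of U on [0, 1]. *)
Definition sqrt_beta_poly m : {poly R} :=
  (2 * m)%:R *: ('X * (1 - 'X^2) ^+ m.-1).

Lemma horner_sqrt_beta_poly m (u : R) :
  (sqrt_beta_poly m).[u] = (2 * m)%:R * (u * (1 - u ^+ 2) ^+ m.-1).
Proof. by rewrite /sqrt_beta_poly !hornerE. Qed.

Lemma sqrt_beta_poly_ge0 m (u : R) :
  0 <= u <= 1 -> 0 <= (sqrt_beta_poly m).[u].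
Proof.
move=> /andP[u0 u1]; rewrite horner_sqrt_beta_poly !mulr_ge0// exprn_ge0//.
by rewrite subr_ge0 expr_le1.
Qed.

Lemma deriv_sqrt_beta m :
  ((1 - 'X^2) ^+ m : {poly R})^`() = - sqrt_beta_poly m.
Proof.
rewrite deriv_exp /sqrt_beta_poly natrM -!mul_polyC polyCM !polyC_natr.
by rewrite !poly.derivE -mulr_natl; ring.
Qed.

Lemma pint_sqrt_beta_poly m (a b : R) :
  pint a b (sqrt_beta_poly m) = (1 - a ^+ 2) ^+ m - (1 - b ^+ 2) ^+ m.
Proof.
have := pint_deriv a b ((1 - 'X^2) ^+ m); rewrite deriv_sqrt_beta raddfN /=.
by rewrite !hornerE => /eqP; rewrite eqr_oppLR opprB => /eqP.
Qed.

Let vanish1 k m : (0 < m)%N -> ('X^k * (1 - 'X^2) ^+ m : {poly R}).[1] = 0.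
Proof.
move=> m0; rewrite hornerM hornerXn horner_exp hornerD hornerN hornerXn hornerC.
by rewrite !expr1n subrr expr0n (gtn_eqF m0) mulr0.
Qed.

Let vanish0 k m : (0 < k)%N -> ('X^k * (1 - 'X^2) ^+ m : {poly R}).[0] = 0.
Proof. by move=> k0; rewrite hornerM hornerXn expr0n (gtn_eqF k0) mul0r. Qed.

(** The moments of order 2 and 4 of U come from integration by parts against
    (1 - x^2)^m, which raises m by one and lowers the order by two. *)
Lemma pint_sqrt_beta_polyX2 m : (0 < m)%N ->
  pint 0 1 (sqrt_beta_poly m * 'X^2) = m.+1%:R^-1 :> R.
Proof.
move=> m0; have := pint_deriv 0 1 ('X^2 * (1 - 'X^2) ^+ m : {poly R}).
rewrite derivM deriv_sqrt_beta.
have -> : ('X^2 : {poly R})^`() * (1 - 'X^2) ^+ m + 'X^2 * - sqrt_beta_poly m =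
   m.+1%:R^-1 *: sqrt_beta_poly m.+1 - sqrt_beta_poly m * 'X^2.
  rewrite [sqrt_beta_poly m.+1]/sqrt_beta_poly scalerA natrM mulrCA.
  rewrite mulVf ?pnatr_eq0//.
  by rewrite mulr1 derivXn/= -mul_polyC polyC_natr; ring.
rewrite raddfB /= pintZ pint_sqrt_beta_poly vanish1// vanish0// subrr.
move=> /eqP; rewrite subr_eq0 => /eqP <-.
by rewrite expr1n subrr !expr0n !subr0 expr1n mulr1.
Qed.

Lemma pint_sqrt_beta_polyX4 m : (0 < m)%N ->
  pint 0 1 (sqrt_beta_poly m * 'X^4) = 2 / (m.+1%:R * m.+2%:R) :> R.
Proof.
move=> m0; have := pint_deriv 0 1 ('X^4 * (1 - 'X^2) ^+ m : {poly R}).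
rewrite derivM deriv_sqrt_beta.
have -> : ('X^4 : {poly R})^`() * (1 - 'X^2) ^+ m + 'X^4 * - sqrt_beta_poly m =
   (2 / m.+1%:R) *: (sqrt_beta_poly m.+1 * 'X^2) - sqrt_beta_poly m * 'X^4.
  rewrite [sqrt_beta_poly m.+1]/sqrt_beta_poly -scalerAl scalerA natrM mulrCA.
  rewrite divfK ?pnatr_eq0//.
  by rewrite derivXn/= -natrM -mul_polyC polyC_natr; ring.
rewrite raddfB /= pintZ pint_sqrt_beta_polyX2// vanish1// vanish0// subrr.
by move=> /eqP; rewrite subr_eq0 => /eqP <-; rewrite invfM mulrA.
Qed.

(** E[(X - a)^2 | U = u], as conditional variance plus squared bias. *)
Definition mix_sqdev n m (a u : R) : R :=
  let p := 2 * u / (1 + u) in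
  n%:R * u * (1 - u) + m.-1%:R * p * (1 - p)
    + (1 + n%:R * u + m.-1%:R * p - a) ^+ 2.

Let kern g n m u := (map_poly (pgfE g) (mix_pgf R n m)).[u].

Let kernE g n m u : 0 <= u -> kern g n m u = (sqrt_beta_poly m).[u] *
  pgfE g (bern u ^+ n * (bern (2 * u / (1 + u)) ^+ m.-1 * 'X)).
Proof.
move=> u0; rewrite /kern horner_map_pgfE horner_mix_pgf// pgfEZ.
by rewrite horner_sqrt_beta_poly !mulrA.
Qed.

Lemma success_prob (u : R) : 0 <= u <= 1 -> 0 <= 2 * u / (1 + u) <= 1.
Proof.
move=> /andP[u0 u1]; have u1' : 0 < 1 + u by rewrite ltr_pwDl.
by rewrite divr_ge0 ?mulr_ge0 ?(ltW u1')//= ler_pdivrMr//; lra.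
Qed.

Lemma mix_kernel_le g n m (c s a u : R) : 0 <= u <= 1 ->
  (forall k, g k <= c + s * (k%:R - a) ^+ 2) ->
  (map_poly (pgfE g) (mix_pgf R n m)).[u] <=
    (sqrt_beta_poly m).[u] * (c + s * mix_sqdev n m a u).
Proof.
move=> u01 gle; have /andP[u0 u1] := u01.
rewrite -/(kern g n m u) kernE// ler_wpM2l ?sqrt_beta_poly_ge0//.
apply: le_trans (pgfE_le _ gle) _.
  apply: coef_bernX_ge0 => // k; apply: coef_bernX_ge0.
    exact: success_prob.
  by move=> j; rewrite coefX.
rewrite !pgfE_sqr_bernX -['X]expr1 pgfEX /mix_sqdev le_eqVlt; apply/orP; left.
by apply/eqP; ring.
Qed.

(** Chebyshev's inequality, kept pointwise in u.  Bounding g by a constant plus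
    a multiple of the squared deviation bounds its conditional expectation, and
    integrating over U with different constants below and above b produces
    P(U <= b), P(U > b) and an averaged mean square.  Negative constants are
    allowed: they give the lower bounds. *)
Lemma mix_law_cut g n m (kap b c1 c2 s : R) V : (0 < m)%N -> 0 <= b <= 1 ->
  (forall u k, 0 <= u <= b -> g k <= c1 + s * (k%:R - kap * u) ^+ 2) ->
  (forall u k, b <= u <= 1 -> g k <= c2 + s * (k%:R - kap * u) ^+ 2) ->
  (forall u, 0 <= u <= 1 -> s * mix_sqdev n m (kap * u) u <= V.[u]) ->
  mix_law g n m <= c1 * (1 - (1 - b ^+ 2) ^+ m) + c2 * (1 - b ^+ 2) ^+ m
      + pint 0 1 (sqrt_beta_poly m * V).
Proof.
move=> m0 /andP[b0 b1] g1 g2 vV.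
have mixE : mix_law g n m = pint 0 1 (map_poly (pgfE g) (mix_pgf R n m)).
  by case: m m0 {vV}.
have piece (a e c : R) : 0 <= a -> a <= e -> e <= 1 ->
    (forall u k, a <= u <= e -> g k <= c + s * (k%:R - kap * u) ^+ 2) ->
    pint a e (map_poly (pgfE g) (mix_pgf R n m)) <=
    c * ((1 - a ^+ 2) ^+ m - (1 - e ^+ 2) ^+ m)
      + pint a e (sqrt_beta_poly m * V).
  move=> a0 ae e1 gu; rewrite -pint_sqrt_beta_poly -pintZ -raddfD /=.
  apply: pint_le => // u /andP[au ue].
  have u01 : 0 <= u <= 1 by rewrite (le_trans a0 au) (le_trans ue e1).
  apply: le_trans (mix_kernel_le n m u01 (gu u ^~ _)) _; first by rewrite au.
  rewrite hornerD hornerZ hornerM mulrC [c * _]mulrC -mulrDr mulrC.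
  by rewrite ler_wpM2l ?sqrt_beta_poly_ge0// lerD2l vV.
rewrite mixE (pint_cut 0 b 1) (pint_cut 0 b 1 (_ * V)).
have := piece 0 b c1 (lexx 0) b0 b1 g1; have := piece b 1 c2 b0 b1 (lexx 1) g2.
rewrite expr0n /= subr0 !expr1n subrr [0 ^+ m]expr0n (gtn_eqF m0) /= subr0.
by move=> ? ?; lra.
Qed.

Lemma mix_lawN g n m : mix_law (fun k => - g k) n m = - mix_law g n m.
Proof.
case: m => // m; rewrite /mix_law -raddfN /=; congr pint; apply/polyP => i.
rewrite coefN !coef_map_id0 ?raddf0// -sumrN; apply: eq_bigr => k _.
by rewrite mulrN.
Qed.

Definition mix_cdf n m (t : R) : R := mix_law (fun k => (k%:R <= t)%R%:R) n m.

Lemma mix_cdf_01 n m t : (0 < m)%N -> 0 <= mix_cdf n m t <= 1.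
Proof.
move=> m0.
have V0 u : 0 <= u <= 1 -> 0 * mix_sqdev n m (0 * u) u <= (0 : {poly R}).[u].
  by rewrite mul0r horner0.
have I0 : 0 <= (0 : R) <= 1 by rewrite lexx ler01.
have pV : pint 0 1 (sqrt_beta_poly m * 0) = 0 :> R by rewrite mulr0 raddf0.
apply/andP; split.
  rewrite -oppr_le0 -mix_lawN.
  have := @mix_law_cut (fun k => - (k%:R <= t)%R%:R) n m 0 0 0 0 0 0 m0 I0.
  rewrite pV !mul0r !addr0; apply => // u k _;
    by rewrite mul0r addr0 oppr_le0 ler0n.
have := @mix_law_cut (fun k => (k%:R <= t)%R%:R) n m 0 0 1 1 0 0 m0 I0.
rewrite pV !mul1r subrK addr0; apply => // u k _;
  by rewrite mul0r addr0 lern1 leq_b1.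
Qed.

(** The clipping to [0, 1] extends P(U <= y) = 1 - (1 - y^2)^m to all real y. *)
Definition sqrt_beta_cdf m (y : R) : R :=
  1 - (1 - (Num.max 0 (Num.min 1 y)) ^+ 2) ^+ m.

Let sqr_ratio_ge1 (rho y : R) :
  0 < rho -> rho <= `|y| -> 1 <= rho ^- 2 * y ^+ 2.
Proof.
move=> rho0 h; rewrite mulrC ler_pdivlMr ?exprn_gt0// mul1r.
by rewrite -(real_normK (num_real y)) lerXn2r ?nnegrE ?(ltW rho0).
Qed.

(** If X is close to kap * U in mean square, X <= t forces U below b up to a
    Chebyshev error, as soon as t lies below kap * b by a margin rho: for
    u >= b, every k <= t is at distance at least rho from kap * u. *)
Lemma mix_cdf_le n m (kap t rho b w : R) V : (0 < m)%N ->
  0 <= kap -> 0 < rho -> t + rho <= kap * b ->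
  (forall u, 0 <= u <= 1 -> mix_sqdev n m (kap * u) u <= V.[u]) ->
  pint 0 1 (sqrt_beta_poly m * V) <= w -> 0 <= w ->
  mix_cdf n m t <= sqrt_beta_cdf m b + w / rho ^+ 2.
Proof.
move=> m0 kap0 rho0 tb vV Vw w0.
have r2 : 0 <= rho ^- 2 by rewrite invr_ge0 exprn_ge0// ltW.
have wr0 : 0 <= w / rho ^+ 2 by rewrite mulr_ge0.
rewrite /sqrt_beta_cdf; case: (leP 1 b) => b1.
  rewrite max_r// expr1n subrr expr0n (gtn_eqF m0) subr0.
  have /andP[_] := mix_cdf_01 n t m0.
  by move/le_trans; apply; rewrite lerDl.
set c := Num.max 0 b.
have c01 : 0 <= c <= 1 by rewrite le_max lexx ge_max ler01 (ltW b1).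
have := @mix_law_cut (fun k => (k%:R <= t)%R%:R) n m kap c 1 0 (rho ^- 2)
  (rho ^- 2 *: V) m0 c01.
rewrite mul1r mul0r addr0 -scalerAr pintZ => H.
apply: le_trans (H _ _ _) _.
- move=> u k _; rewrite ler_wpDr ?lern1 ?leq_b1//.
  by rewrite mulr_ge0 ?sqr_ge0.
- move=> u k /andP[cu u1]; rewrite add0r.
  case: (boolP (k%:R <= t)) => kt; last first.
    by rewrite mulr_ge0 ?sqr_ge0.
  have bu : kap * b <= kap * u.
    by rewrite ler_wpM2l// (le_trans _ cu)// le_max lexx orbT.
  by apply: sqr_ratio_ge1 => //; rewrite ler_normr; apply/orP; right; lra.
- by move=> u u01; rewrite hornerZ ler_wpM2l ?vV.
- by rewrite lerD2l mulrC ler_wpM2r.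
Qed.

Lemma mix_cdf_ge n m (kap t rho a w : R) V : (0 < m)%N ->
  0 <= kap -> 0 < rho -> kap * a + rho <= t ->
  (forall u, 0 <= u <= 1 -> mix_sqdev n m (kap * u) u <= V.[u]) ->
  pint 0 1 (sqrt_beta_poly m * V) <= w -> 0 <= w ->
  sqrt_beta_cdf m a - w / rho ^+ 2 <= mix_cdf n m t.
Proof.
move=> m0 kap0 rho0 ta vV Vw w0.
have r2 : 0 <= rho ^- 2 by rewrite invr_ge0 exprn_ge0// ltW.
have wr0 : 0 <= w / rho ^+ 2 by rewrite mulr_ge0.
rewrite /sqrt_beta_cdf; case: (ltP a 0) => a0.
  rewrite max_l ?ge_min ?(ltW a0) ?orbT// expr0n subr0 expr1n subrr add0r.
  have /andP[+ _] := mix_cdf_01 n t m0.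
  by apply: le_trans; rewrite oppr_le0.
rewrite max_r ?le_min ?ler01//; set c := Num.min 1 a.
have c01 : 0 <= c <= 1 by rewrite ge_min lexx le_min ler01 a0.
have := @mix_law_cut (fun k => - (k%:R <= t)%R%:R) n m kap c (-1) 0 (rho ^- 2)
  (rho ^- 2 *: V) m0 c01.
rewrite mulN1r mul0r addr0 -scalerAr pintZ mix_lawN => H.
have Ww : rho ^- 2 * pint 0 1 (sqrt_beta_poly m * V) <= w / rho ^+ 2.
  by rewrite mulrC ler_wpM2r.
suff: - mix_cdf n m t <= - (1 - (1 - c ^+ 2) ^+ m)
    + rho ^- 2 * pint 0 1 (sqrt_beta_poly m * V) by lra.
apply: H.
- move=> u k /andP[u0 uc]; case: (boolP (k%:R <= t)) => kt.
    by rewrite lerDl mulr_ge0 ?sqr_ge0.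
  have ua : kap * u <= kap * a.
    by rewrite ler_wpM2l// (le_trans uc)// ge_min lexx orbT.
  rewrite -ltNge in kt; rewrite oppr0 addrC subr_ge0 sqr_ratio_ge1// ler_normr.
  by apply/orP; left; lra.
- move=> u k _; rewrite add0r.
  apply: (@le_trans _ _ 0); first by rewrite oppr_le0 ler0n.
  by rewrite mulr_ge0 ?sqr_ge0.
- by move=> u u01; rewrite hornerZ ler_wpM2l ?vV.
Qed.

End Concentration.

(** * The law of the final number of white balls *)

Section UrnLaw.

Lemma urn_initE n b :
  (urn_init n b 0 white = n%:Z) * (urn_init n b 0 black = b%:Z).
Proof. by rewrite !mxE. Qed.

Lemma urn_draw_white n b :
  urn_init n.+1 b + row white urnM = urn_init n b.
Proof.
apply/rowP => i; rewrite !mxE eqxx; case: eqP => _ /=; last by rewrite addr0.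
by rewrite -addn1 PoszD addrK.
Qed.

Lemma urn_draw_black n j :
  urn_init n (2 * j.+1) + row black urnM = urn_init n.+1 (2 * j).
Proof.
apply/rowP => i; rewrite !mxE /=; case: eqP => _ /=.
  by rewrite -addn1 PoszD.
by rewrite mulnS addnC PoszD addrK.
Qed.

Lemma urn_content_rcons M v h c :
  urn_content M v (rcons h c) = urn_content M v h + row c M.
Proof. by rewrite /urn_content foldl_rcons. Qed.

Lemma ord2P (c : 'I_2) : c = white \/ c = black.
Proof. by case: c => [[|[|//]]] i; [left|right]; apply/val_inj. Qed.

Lemma history_rcons (T : Type) (C : nat -> T -> 'I_2) t w h c :
  (history C t.+1 w = rcons h c) <-> (history C t w = h /\ C t w = c).
Proof.
rewrite /history mkseqS; split=> [/rcons_inj[]//|[-> ->]//].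
Qed.

Lemma take_history (T : Type) (C : nat -> T -> 'I_2) s t w : (s <= t)%N ->
  take s (history C t w) = history C s w.
Proof.
by move=> st; rewrite /history /mkseq -map_take take_iota (minn_idPl st).
Qed.

Context {R : realType} {d : measure_display} {T : measurableType d}.
Variables (P : probability T R) (C : nat -> T -> 'I_2) (X : {RV P >-> R}).
Variables (n m : nat).
Hypothesis drawsC : urn_draws P urnM (urn_init n (2 * m)) C.
Hypothesis finalX : final_white urnM (urn_init n (2 * m)) C X.

Let hist h := [set w | history C (size h) w = h].
Let le_X t := [set w | X w <= t].
Let content h := urn_content urnM (urn_init n (2 * m)) h.

Let measurable_hist h : measurable (hist h).
Proof.
elim/last_ind: h => [|h c IH].
  by rewrite (_ : hist _ = setT)//; apply/seteqP.
have -> : hist (rcons h c) = hist h `&` [set w | C (size h) w = c].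
  by apply/seteqP; split => w; rewrite /hist /= size_rcons history_rcons.
by apply: measurableI => //; exact: drawsC.1.
Qed.

Let measurable_le_X t : measurable (le_X t).
Proof.
have -> : le_X t = X @^-1` `]-oo, t].
  by apply/seteqP; split => w; rewrite /le_X /= in_itv.
by rewrite -[_ @^-1` _]setTI; exact: measurable_funP.
Qed.

Lemma urn_law_stopped t h w : content h = urn_init w 0 ->
  (forall i, (i < size h)%N -> content (take i h) 0 black != 0) ->
  P (hist h `&` le_X t) = (P (hist h) * (mix_cdf w 0 t)%:E)%E.
Proof.
move=> ch hrun.
have XE y : hist h y -> X y = w%:R.
  move=> hy; rewrite (finalX (t := size h)).
    by rewrite hy -/(content h) ch urn_initE.
  split=> [|s sh]; first by rewrite hy -/(content h) ch urn_initE.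
  by rewrite -(take_history C y (ltnW sh)) hy; exact: hrun.
rewrite /mix_cdf /mix_law; case: (boolP (w%:R <= t)) => wt.
  rewrite mule1; congr (P _); apply/seteqP; split => y; first by case.
  by move=> hy; split; rewrite /le_X/= ?XE.
rewrite mule0 (_ : _ `&` _ = set0) ?measure0//; apply/seteqP; split => y //.
by case=> hy; rewrite /le_X/= XE// (negPf wt).
Qed.

(** Each draw lowers w + 2j by one, so the process stops after at most
    n + 2m draws and induction on w + 2j unrolls it; one step is the
    first-step recursion of the mixture. *)
Lemma urn_law_history t k h w j : (w + 2 * j)%N = k ->
  content h = urn_init w (2 * j) ->
  (forall i, (i < size h)%N -> content (take i h) 0 black != 0) ->
  P (hist h `&` le_X t) = (P (hist h) * (mix_cdf w j t)%:E)%E.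
Proof.
elim: k h w j => [|k IH] h w [|j] wjk ch hrun.
- exact: urn_law_stopped.
- by move: wjk; rewrite mulnS !addnS.
- exact: urn_law_stopped.
have bl : content h 0 black != 0 by rewrite ch urn_initE.
have run : urn_running urnM (urn_init n (2 * m)) h.
  move=> i; rewrite leq_eqVlt => /predU1P[->|]; last exact: hrun.
  by rewrite take_size.
have draw c : P (hist (rcons h c)) =
    (P (hist h) * (draw_prob R (urn_init w (2 * j.+1)) c)%:E)%E.
  by rewrite -ch /hist size_rcons; exact: drawsC.2.
have crun c i : (i < size (rcons h c))%N ->
    content (take i (rcons h c)) 0 black != 0.
  rewrite size_rcons ltnS => ih; rewrite -cats1 takel_cat//; exact: run.
have -> : P (hist h `&` le_X t) = (P (hist (rcons h white) `&` le_X t) +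
    P (hist (rcons h black) `&` le_X t))%E.
  rewrite -measureU; first last.
  - apply/seteqP; split => // y [[+ _] [+ _]].
    rewrite /hist /= !size_rcons !history_rcons => -[_ ->] [_].
    by move=> /(congr1 val).
  - exact: measurableI.
  - exact: measurableI.
  congr (P _); rewrite -setIUl; congr (_ `&` _); apply/seteqP; split=> y.
    rewrite /hist /= !size_rcons !history_rcons => ->.
    by case: (ord2P (C (size h) y)) => ->; [left|right].
  by rewrite /hist /= !size_rcons !history_rcons => -[[]|[]].
have -> : P (hist (rcons h black) `&` le_X t) =
    (P (hist (rcons h black)) * (mix_cdf w.+1 j t)%:E)%E.
  apply: IH (crun _); first lia.
  by rewrite /content urn_content_rcons -/(content h) ch urn_draw_black.
have -> : P (hist (rcons h white) `&` le_X t) =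
    (P (hist (rcons h white)) * (mix_cdf w.-1 j.+1 t)%:E)%E.
  case: w wjk ch draw => [|w] wjk ch draw.
    (* Drawing a white ball from an urn without any leads to a null event, on
       which the content would be negative and the induction is void. *)
    have P0 : P (hist (rcons h white)) = 0%E.
      by rewrite draw /draw_prob urn_initE mul0r mule0.
    rewrite P0 mul0e; apply/eqP; rewrite eq_le measure_ge0 andbT -P0.
    by apply: le_measure; rewrite ?inE//; apply: measurableI.
  apply: IH (crun _); first lia.
  by rewrite /content urn_content_rcons -/(content h) ch urn_draw_white.
rewrite !draw -[P (hist h)]fineK ?fin_num_measure// -!EFinM -EFinD.
congr EFin; rewrite -!mulrA -mulrDr; congr (_ * _).
have rec : (w + 2 * j.+1)%:R * mix_cdf w j.+1 t =
    w%:R * mix_cdf w.-1 j.+1 t + (2 * j.+1)%:R * mix_cdf w.+1 j t.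
  exact: (@mix_law_rec R _ w j.+1 isT).
have N0 : (w + 2 * j.+1)%:R != 0 :> R by rewrite pnatr_eq0; lia.
rewrite /draw_prob !urn_initE -PoszD -!pmulrn; apply: (mulfI N0).
rewrite rec; move: (mulfV N0); move: (_%:R^-1) => N' NN'.
rewrite mulrDr (mulrCA _ w%:R) (mulrCA _ (2 * j.+1)%:R) !(mulrA _ N').
by rewrite NN' !mul1r.
Qed.

Lemma urn_law t : P (le_X t) = (mix_cdf n m t)%:E.
Proof.
have := @urn_law_history t (n + 2 * m) [::] n m erefl erefl.
have -> : hist [::] = setT by apply/seteqP.
by rewrite setTI probability_setT mul1e; apply.
Qed.

End UrnLaw.

(** * Mean-square errors in the two regimes *)

Section VarianceBounds.
Variable R : realType.
Implicit Types u s : R.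

(** Polynomial bounds on 2u/(1+u) which agree to first order at 0, the point
    near which U concentrates as m grows. *)
Lemma success_prob_bounds u : 0 <= u <= 1 ->
  2 * u * (1 - u) <= 2 * u / (1 + u) <= 2 * u.
Proof.
move=> /andP[u0 u1]; have u1' : 0 < 1 + u by rewrite ltr_pwDl.
rewrite ler_pdivlMr// ler_pdivrMr//; nra.
Qed.

(** The variance is at most (n + 2m)u and the bias at most 1 + 2mu^2.  The
    odd power u is traded for even ones by 2u <= 1/s + su^2, to be used with
    s = sqrt m, because the even moments of U are the explicit ones. *)
Lemma mix_sqdev_le_grow n m s u : (0 < m)%N -> 0 < s -> 0 <= u <= 1 ->
  mix_sqdev n m ((n + 2 * m)%:R * u) u <=
  (n + 2 * m)%:R / 2 * (s^-1 + s * u ^+ 2) + 2 + 8 * (m%:R ^+ 2 * u ^+ 4).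
Proof.
case: m => // m _ s0 u01; rewrite /mix_sqdev [m.+1.-1]/=.
have := success_prob_bounds u01; have := success_prob u01.
move: (2 * u / (1 + u)) => p /andP[p0 p1] /andP[pl pu].
have /andP[u0 u1] := u01.
have m0 : 0 <= m%:R :> R by [].
have n0 : 0 <= n%:R :> R by [].
rewrite natrD natrM -[m.+1%:R]natr1; move: (m%:R) (n%:R) m0 n0 => a b a0 b0.
have am : 2 * u <= s^-1 + s * u ^+ 2.
  rewrite -subr_ge0 (_ : _ - _ = s * (u - s^-1) ^+ 2); last first.
    by field; rewrite gt_eqF.
  by rewrite mulr_ge0 ?sqr_ge0// ltW.
have var : b * u * (1 - u) + a * p * (1 - p) <= (b + 2 * (a + 1)) * u.
  have : b * u * (1 - u) <= b * u.
    by rewrite ler_piMr ?mulr_ge0// lerBlDr lerDl.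
  have : a * p * (1 - p) <= a * (2 * u).
    by rewrite -mulrA ler_wpM2l// (le_trans _ pu)// ler_piMr// lerBlDr lerDl.
  by lra.
have bias1 : 1 + b * u + a * p - (b + 2 * (a + 1)) * u <= 1.
  have : a * p <= a * (2 * u) by rewrite ler_wpM2l.
  lra.
have bias2 : - 1 - 2 * (a + 1) * u ^+ 2 <=
    1 + b * u + a * p - (b + 2 * (a + 1)) * u.
  have : a * (2 * u * (1 - u)) <= a * p by rewrite ler_wpM2l.
  have : 0 <= (1 - u) ^+ 2 by rewrite sqr_ge0.
  nra.
move: (1 + b * u + _ - _) bias1 bias2 => y y1 y2.
have yh : y ^+ 2 <= 2 + 8 * ((a + 1) ^+ 2 * u ^+ 4).
  pose h := 2 * (a + 1) * u ^+ 2.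
  have h0 : 0 <= h by rewrite mulr_ge0 ?sqr_ge0//; lra.
  rewrite -/h in y2.
  have : 0 <= (1 + h - y) * (1 + h + y) by apply: mulr_ge0; lra.
  have : 0 <= (1 - h) ^+ 2 by rewrite sqr_ge0.
  rewrite (_ : 8 * _ = 2 * h ^+ 2); last by rewrite /h; ring.
  nra.
have : (b + 2 * (a + 1)) * (2 * u) <= (b + 2 * (a + 1)) * (s^-1 + s * u ^+ 2).
  by rewrite ler_wpM2l//; lra.
lra.
Qed.

(** With m fixed the binomial variance is at most n and the pairs contribute
    at most m white balls, which bounds their bias and their variance. *)
Lemma mix_sqdev_le_fixed n m u : (0 < m)%N -> 0 <= u <= 1 ->
  mix_sqdev n m (n%:R * u) u <= n%:R + m%:R + m%:R ^+ 2.
Proof.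
case: m => // m _ u01; rewrite /mix_sqdev [m.+1.-1]/=.
have := success_prob u01.
move: (2 * u / (1 + u)) => p /andP[p0 p1].
have /andP[u0 u1] := u01.
have m0 : 0 <= m%:R :> R by [].
have n0 : 0 <= n%:R :> R by [].
rewrite -[m.+1%:R]natr1; move: (m%:R) (n%:R) m0 n0 => a b a0 b0.
have v1 : b * u * (1 - u) <= b.
  by rewrite -mulrA ler_piMr// mulr_ile1//; lra.
have v2 : a * p * (1 - p) <= a.
  by rewrite -mulrA ler_piMr// mulr_ile1//; lra.
have : (1 + b * u + a * p - b * u) ^+ 2 <= (a + 1) ^+ 2.
  have : a * p <= a by rewrite ler_piMr.
  have : 0 <= a * p by rewrite mulr_ge0.
  by move=> ? ?; rewrite lerXn2r ?nnegrE//; lra.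
lra.
Qed.

(** Here kap = n and the margin is rho = n * del; the averaged mean square
    n + m + m^2 is divided by n^2. *)
Lemma mix_cdf_bounds_fixed n m (x del : R) :
  (0 < m)%N -> (0 < n)%N -> 0 < del ->
  sqrt_beta_cdf m (x - del) - (1 + m%:R + m%:R ^+ 2) / n%:R / del ^+ 2
    <= mix_cdf n m (n%:R * x)
    <= sqrt_beta_cdf m (x + del) + (1 + m%:R + m%:R ^+ 2) / n%:R / del ^+ 2.
Proof.
move=> m0 n0 del0; set e := _ / n%:R; have nR : 0 < n%:R :> R by rewrite ltr0n.
have nR1 : 1 <= n%:R :> R by rewrite ler1n.
pose w : R := n%:R + m%:R + m%:R ^+ 2.
have w0 : 0 <= w by rewrite /w !addr_ge0// sqr_ge0.
have ew : w / (n%:R * del) ^+ 2 <= e / del ^+ 2.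
  rewrite exprMn invfM mulrA ler_wpM2r ?invr_ge0 ?sqr_ge0// /e.
  rewrite ler_pdivrMr ?exprn_gt0// (expr2 n%:R) mulrA divfK ?gt_eqF//.
  have : 0 <= m%:R :> R by [].
  have : 0 <= m%:R ^+ 2 :> R by rewrite sqr_ge0.
  rewrite /w; nra.
have V u : 0 <= u <= 1 -> mix_sqdev n m (n%:R * u) u <= (w%:P).[u].
  by move=> u01; rewrite hornerC; exact: mix_sqdev_le_fixed.
have Iw : pint 0 1 (sqrt_beta_poly R m * w%:P) <= w :> R.
  rewrite mulrC mul_polyC pintZ pint_sqrt_beta_poly expr1n subrr.
  by rewrite !expr0n (gtn_eqF m0) !subr0 expr1n mulr1.
have rho0 : 0 < n%:R * del by rewrite mulr_gt0.
have lo : n%:R * (x - del) + n%:R * del <= n%:R * x by lra.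
have hi : n%:R * x + n%:R * del <= n%:R * (x + del) by lra.
have := @mix_cdf_ge R n m n%:R _ _ (x - del) w w%:P m0 (ltW nR) rho0 lo V Iw w0.
have := @mix_cdf_le R n m n%:R _ _ (x + del) w w%:P m0 (ltW nR) rho0 hi V Iw w0.
move: ew; move: (w / _) (e / _) => a b ab Hle Hge.
by apply/andP; split; lra.
Qed.

(** Here kap = n + 2m and the margin is rho = (kap / sqrt m) * del.  The
    averaged mean square is at most kap / sqrt m + 18, and dividing
    it by (kap / sqrt m)^2, where kap / sqrt m >= 2 sqrt m, leaves at most
    5 / sqrt m, whatever n is. *)
Lemma mix_cdf_bounds_grow n m (x del : R) : (0 < m)%N -> 0 < del ->
  sqrt_beta_cdf m ((x - del) / Num.sqrt m%:R)
      - 5 / Num.sqrt m%:R / del ^+ 2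
    <= mix_cdf n m ((n%:R / Num.sqrt m%:R + 2 * Num.sqrt m%:R) * x)
    <= sqrt_beta_cdf m ((x + del) / Num.sqrt m%:R)
      + 5 / Num.sqrt m%:R / del ^+ 2.
Proof.
move=> m0 del0; set s := Num.sqrt m%:R.
have mR : 1 <= m%:R :> R by rewrite ler1n.
have s1 : 1 <= s by rewrite -sqrtr1 ler_wsqrtr.
have s0 : 0 < s by rewrite (lt_le_trans ltr01).
have ss : s ^+ 2 = m%:R by rewrite sqr_sqrtr.
pose kap : R := (n + 2 * m)%:R.
have kapE : kap = n%:R + 2 * s ^+ 2 by rewrite /kap natrD natrM ss.
have kap0 : 0 < kap by rewrite kapE ltr_wpDl// mulr_gt0// exprn_gt0.
have -> : n%:R / s + 2 * s = kap / s by rewrite kapE; field; rewrite gt_eqF.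
pose V : {poly R} := (kap / 2 / s + 2)%:P + (kap / 2 * s) *: 'X^2 +
  (8 * m%:R ^+ 2) *: 'X^4.
pose w : R := kap / s + 18.
have w0 : 0 <= w by rewrite addr_ge0// divr_ge0// ltW.
have VE u : 0 <= u <= 1 -> mix_sqdev n m (kap * u) u <= V.[u].
  move=> u01; apply: le_trans (mix_sqdev_le_grow n m0 s0 u01) _.
  rewrite /V !(hornerD, hornerC, hornerZ, hornerXn) -/kap le_eqVlt.
  by apply/orP; left; apply/eqP; ring.
have Iw : pint 0 1 (sqrt_beta_poly R m * V) <= w :> R.
  have : pint 0 1 (sqrt_beta_poly R m) = 1.
    rewrite pint_sqrt_beta_poly expr1n subrr !expr0n (gtn_eqF m0) !subr0.
    by rewrite expr1n.
  have := pint_sqrt_beta_polyX2 R m0; have := pint_sqrt_beta_polyX4 R m0.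
  move: (sqrt_beta_poly R m) => f f4 f2 f0.
  have fC (a : R) : pint 0 1 (f * a%:P) = a.
    by rewrite mulrC mul_polyC pintZ f0 mulr1.
  rewrite /V !mulrDr -!(scalerAr _ f) !(raddfD (pint 0 1)) /= fC.
  rewrite (pintZ 0 1 (kap / 2 * s)) (pintZ 0 1 (8 * m%:R ^+ 2)) f2 f4 /w.
  have b1 : kap / 2 * s / m.+1%:R <= kap / 2 / s.
    rewrite -!mulrA ler_wpM2l ?(ltW kap0)// ler_wpM2l// ler_pdivrMr// mulrC.
    by rewrite ler_pdivlMr// -expr2 ss ler_nat.
  have b2 : 8 * m%:R ^+ 2 * (2 / (m.+1%:R * m.+2%:R)) <= 16 :> R.
    rewrite mulrA ler_pdivrMr ?mulr_gt0// -[m.+2%:R]natr1 -[m.+1%:R]natr1.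
    nra.
  have -> : kap / s = kap / 2 / s + kap / 2 / s by field; rewrite gt_eqF.
  move: (kap / 2 / s) (kap / 2 * s / _) (8 * _ * _) b1 b2 => a b c ab c16.
  lra.
have rho0 : 0 < kap / s * del by rewrite mulr_gt0 ?divr_gt0.
have ew : w / (kap / s * del) ^+ 2 <= 5 / s / del ^+ 2.
  rewrite exprMn invfM mulrA ler_wpM2r ?invr_ge0 ?sqr_ge0//.
  rewrite /w; have : 2 * s <= kap / s.
    by rewrite ler_pdivlMr// -mulrA -expr2 kapE lerDr.
  move: (kap / s) => c cs.
  have c2 : 2 <= c by rewrite (le_trans _ cs)// ler_peMr.
  have c0 : 0 < c by lra.
  rewrite ler_pdivrMr ?exprn_gt0// mulrAC ler_pdivlMr//; nra.
have kx (y : R) : kap * (y / s) = kap / s * y by rewrite mulrA mulrAC.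
have lo : kap * ((x - del) / s) + kap / s * del <= kap / s * x.
  by rewrite kx; lra.
have hi : kap / s * x + kap / s * del <= kap * ((x + del) / s).
  by rewrite kx; lra.
have := @mix_cdf_ge R n m kap _ _ _ w V m0 (ltW kap0) rho0 lo VE Iw w0.
have := @mix_cdf_le R n m kap _ _ _ w V m0 (ltW kap0) rho0 hi VE Iw w0.
move: ew; move: (w / _) (5 / s / _) => a b ab Hle Hge.
by apply/andP; split; lra.
Qed.

End VarianceBounds.

(** * Distribution functions of the limit laws *)

Section Cdfs.
Variable R : realType.
Local Notation mu := (@lebesgue_measure R).

(** Half-open intervals generate the Borel sets and are differences of left
    half-lines. *)
Lemma measure_eq_of_cdf (m1 m2 : {measure set R -> \bar R}) :
  (forall x : R, m1 `]-oo, x]%classic = m2 `]-oo, x]%classic) ->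
  (forall x : R, m1 `]-oo, x]%classic < +oo)%E ->
  forall A, measurable A -> m1 A = m2 A.
Proof.
move=> m12 fin1.
have itvE (m : {measure set R -> \bar R}) (a b : R) :
    (forall x : R, m `]-oo, x]%classic < +oo)%E -> a <= b ->
    m `]a, b]%classic = (m `]-oo, b]%classic - m `]-oo, a]%classic)%E.
  move=> finm ab.
  have -> : `]a, b]%classic = `]-oo, b]%classic `\` `]-oo, a]%classic.
    by rewrite -[RHS]setCK setCD setCitvl setUC -[LHS]setCK setCitv.
  rewrite measureD// ?setIidr//; first exact: subset_itvl.
  exact: finm.
move=> A mA.
apply: (@measure_unique _ R R (@ocitv R)
  (fun k => `](- k%:R)%R, k%:R]%classic)) mA => //.
- exact: ocitvI.
- by move=> k; exact: is_ocitv.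
- exact: bigcup_itvT.
- move=> _ [[a b] _ <-] /=; case: (leP a b) => ab.
    by rewrite !itvE// -?m12// => y; rewrite -m12.
  by rewrite set_itv_ge ?measure0// bnd_simp -leNgt ltW.
- move=> k; apply: le_lt_trans (fin1 k%:R).
  by apply: le_measure; rewrite ?inE//; exact: subset_itvr.
Qed.

(** The three densities at hand are smooth on one interval [0, c] and zero
    elsewhere in the set of integration, so a single use of the fundamental
    theorem of calculus serves them all. *)
Lemma integral_cut_FTC (f g F : R -> R) (U : set R) c : 0 <= c ->
  `[0, c] `<=` U -> (forall y, U y -> f y = if 0 <= y <= c then g y else 0) ->
  continuous g -> (forall y, is_derive y (1 : R) F (g y)) ->
  (\int[mu]_(y in U) (f y)%:E = (F c - F 0)%R%:E)%E.
Proof.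
move=> c0 cU fE cg dF.
transitivity (\int[mu]_(y in `[0%R, c]) (g y)%:E)%E.
  rewrite integral_mkcond [RHS]integral_mkcond; apply: eq_integral => y _.
  rewrite !patchE; case: ifPn => [|nU].
    rewrite inE => Uy; rewrite fE//; case: ifPn => yc.
      by rewrite ifT// inE.
    by rewrite ifF//; apply/negP; rewrite inE /= in_itv/= (negPf yc).
  rewrite ifF//; apply/negP; rewrite inE => /cU Uy.
  by move/negP: nU; apply; rewrite inE.
have := c0; rewrite le_eqVlt => /predU1P[<-|c0'].
  by rewrite set_itv1 integral_set1 subrr.
rewrite (continuous_FTC2 (F := F))//.
- exact: continuous_subspaceT.
- split.
  + by move=> y _; case: (dF y).
  + apply: cvg_at_right_filter; apply: differentiable_continuous.
    by apply/derivable1_diffP; case: (dF 0).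
  + apply: cvg_at_left_filter; apply: differentiable_continuous.
    by apply/derivable1_diffP; case: (dF c).
- by move=> y _; rewrite derive1E; apply: derive_val.
Qed.

Definition rayleigh_cdf (y : R) : R :=
  if 0 <= y then 1 - expR (- y ^+ 2) else 0.

Lemma integral_rayleigh_density (x : R) :
  (\int[mu]_(y in `]-oo, x]) (rayleigh_density y)%:E = (rayleigh_cdf x)%:E)%E.
Proof.
rewrite /rayleigh_cdf; case: leP => x0; last first.
  apply: integral0_eq => y; rewrite /= in_itv /= => yx.
  by rewrite /rayleigh_density leNgt (le_lt_trans yx x0).
have dF (y : R) : is_derive y (1 : R) (fun y => - expR (- y ^+ 2))
    (2 * y * expR (- y ^+ 2)).
  by apply: is_derive_eq; rewrite /GRing.scale /=; ring.
rewrite (integral_cut_FTC (g := fun y => 2 * y * expR (- y ^+ 2))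
  x0 _ _ _ dF)//.
- by rewrite expr0n oppr0 expR0 opprK addrC.
- by move=> y; rewrite /= !in_itv /= => /andP[].
- by move=> y; rewrite /= in_itv /= /rayleigh_density => ->; rewrite andbT.
move=> y; apply: cvgM; first by apply: cvgM; [exact: cvg_cst|exact: cvg_id].
apply: (@continuous_comp _ _ _ (fun y : R => - y ^+ 2) expR).
  by apply: cvgN; exact: exprn_continuous.
exact: continuous_expR.
Qed.

Lemma integral_sqrt_beta_density m (x : R) : (0 < m)%N ->
  (\int[mu]_(y in `]-oo, x]) (sqrt_beta_density m y)%:E =
   (sqrt_beta_cdf m x)%:E)%E.
Proof.
move=> m0; rewrite /sqrt_beta_cdf; case: (ltP x 0) => x0.
  rewrite max_l ?ge_min ?(ltW x0) ?orbT// expr0n subr0 expr1n subrr.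
  apply: integral0_eq => y; rewrite /= in_itv /= => yx.
  by rewrite /sqrt_beta_density leNgt (le_lt_trans yx x0).
rewrite max_r ?le_min ?ler01//; set c := Num.min 1 x.
have c0 : 0 <= c by rewrite le_min ler01.
have dF (y : R) : is_derive y (1 : R) (horner (- (1 - 'X^2) ^+ m))
    (sqrt_beta_poly R m).[y].
  have := @is_derive_poly R (- (1 - 'X^2) ^+ m) y.
  by rewrite derivN deriv_sqrt_beta opprK.
rewrite (integral_cut_FTC (g := horner (sqrt_beta_poly R m)) c0 _ _ _ dF)//.
- rewrite !hornerN !horner_exp !hornerD !hornerN !hornerXn !hornerC.
  by rewrite expr0n subr0 expr1n; congr EFin; ring.
- move=> y; rewrite /= !in_itv /= => /andP[_ yc].
  by rewrite (le_trans yc)// ge_min lexx orbT.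
- move=> y; rewrite /= in_itv /= /sqrt_beta_density => yx.
  by rewrite le_min yx andbT horner_sqrt_beta_poly mulrA.
- exact: continuous_horner.
Qed.

Lemma sqrt_le_beta_prob m (x : R) : (0 < m)%N ->
  beta_prob 1 m [set t | Num.sqrt t <= x] = (sqrt_beta_cdf m x)%:E.
Proof.
move=> m0; rewrite /sqrt_beta_cdf; case: (ltP x 0) => x0.
  rewrite max_l ?ge_min ?(ltW x0) ?orbT// expr0n subr0 expr1n subrr.
  rewrite (_ : mkset _ = set0) ?measure0//; apply/seteqP; split => // t /=.
  by rewrite leNgt (lt_le_trans x0)// sqrtr_ge0.
rewrite max_r ?le_min ?ler01//; set c := Num.min 1 x.
have c0 : 0 <= c by rewrite le_min ler01.
have sqrt_le (t : R) : 0 <= t -> (Num.sqrt t <= x) = (t <= x ^+ 2).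
  by move=> t0; rewrite -[in RHS](sqr_sqrtr t0) ler_sqr ?nnegrE// sqrtr_ge0.
have -> : [set t | Num.sqrt t <= x] = `]-oo, x ^+ 2]%classic.
  apply/seteqP; split => t; rewrite /= in_itv /=; case: (leP 0 t) => t0.
  - by rewrite sqrt_le.
  - by move=> _; rewrite (le_trans (ltW t0)) ?sqr_ge0.
  - by rewrite sqrt_le.
  - by rewrite ltr0_sqrtr.
rewrite -integral_beta_pdf//.
have cx : c ^+ 2 <= x ^+ 2 by rewrite ler_sqr ?nnegrE// ge_min lexx orbT.
have dF (y : R) : is_derive y (1 : R) (horner (- (1 - 'X) ^+ m))
    (m%:R *: (1 - 'X) ^+ m.-1).[y].
  have := @is_derive_poly R (- (1 - 'X) ^+ m) y.
  rewrite derivN deriv_exp !poly.derivE sub0r mulN1r mulNrn opprK.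
  by rewrite -scaler_nat.
rewrite (integral_cut_FTC (g := horner (m%:R *: (1 - 'X) ^+ m.-1)) (sqr_ge0 c)
  _ _ _ dF)//.
- rewrite !hornerN !horner_exp !hornerD !hornerN !hornerX !hornerC subr0 expr1n.
  by congr EFin; ring.
- by move=> t; rewrite /= !in_itv/= => /andP[_ tc]; rewrite (le_trans tc).
- move=> t; rewrite /= in_itv/= => tx.
  have -> : (0 <= t <= c ^+ 2) = (0 <= t <= 1).
    rewrite /c; case: (leP 1 x) => x1; first by rewrite expr1n.
    by rewrite tx (le_trans tx) ?expr_le1// ltW.
  rewrite /beta_pdf -(prednK m0) beta_fun1Sn invrK prednK// patchE XMonemX0n.
  rewrite mem_setE in_itv /= hornerZ horner_exp hornerD hornerN hornerX hornerC.
  by case: ifP; rewrite ?mul0r// mulrC.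
- exact: continuous_horner.
Qed.

(** A nonnegative density integrates to a measure, and a measure is determined
    by its values on left half-lines; hence a density may be recognised on the
    distribution function. *)
Section DensityMeasure.
Variable f : R -> R.
Hypotheses (f0 : forall x, 0 <= f x) (mf : measurable_fun setT f).

Let density_measure (A : set R) : \bar R :=
  (\int[mu]_(x in A) (f x)%:E)%E.

Let density_measure0 : density_measure set0 = 0%E.
Proof. exact: integral_set0. Qed.

Let density_measure_ge0 A : (0 <= density_measure A)%E.
Proof. by apply: integral_ge0 => x _; rewrite lee_fin. Qed.

Let density_measure_sigma_additive : semi_sigma_additive density_measure.
Proof.
move=> /= F mF tF mUF; rewrite /density_measure; apply: cvg_toP.
  apply: ereal_nondecreasing_is_cvgn => m n mn.
  apply: lee_sum_nneg_natr => // k _ _.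
  by apply: integral_ge0 => /= x Fkx; rewrite lee_fin.
rewrite ge0_integral_bigcup//=.
- by apply: measurable_funTS; exact: measurableT_comp.
- by move=> x _; rewrite lee_fin.
Qed.

HB.instance Definition _ := isMeasure.Build _ _ _ density_measure
  density_measure0 density_measure_ge0 density_measure_sigma_additive.

Lemma has_density_of_cdf d (T : measurableType d) (P : probability T R)
    (X : {RV P >-> R}) :
  (forall x, cdf X x = (\int[mu]_(y in `]-oo, x]) (f y)%:E)%E) ->
  has_density X f.
Proof.
move=> cdfE A mA.
apply: (@measure_eq_of_cdf (distribution P X) density_measure) => //.
by move=> x; rewrite -ge0_fin_numE// fin_num_measure.
Qed.

End DensityMeasure.

Lemma sqrt_beta_density_ge0 m (x : R) : 0 <= sqrt_beta_density m x.
Proof.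
rewrite /sqrt_beta_density; case: ifP => // /andP[x0 x1].
by rewrite !mulr_ge0// exprn_ge0// subr_ge0 expr_le1.
Qed.

Lemma measurable_sqrt_beta_density m :
  measurable_fun setT (@sqrt_beta_density R m).
Proof.
have -> : @sqrt_beta_density R m = horner (sqrt_beta_poly R m) \_ `[0, 1].
  apply/funext => x; rewrite patchE mem_setE in_itv /= /sqrt_beta_density.
  by case: ifP => //; rewrite horner_sqrt_beta_poly mulrA.
apply/measurable_restrict => //; rewrite setTI.
apply: measurable_funTS; apply: continuous_measurable_fun.
exact: continuous_horner.
Qed.

Section RandomVariables.
Context d (T : measurableType d) (P : probability T R) (X : {RV P >-> R}).

Lemma cdf_of_rayleigh : has_density X (@rayleigh_density R) ->
  forall x, cdf X x = (rayleigh_cdf x)%:E.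
Proof. by move=> dX x; rewrite /cdf dX// integral_rayleigh_density. Qed.

Lemma cdf_of_sqrt_beta m : (0 < m)%N ->
  (forall A : set R, measurable A ->
     distribution P X A = pushforward (beta_prob 1 m) (@Num.sqrt R) A) ->
  forall x, cdf X x = (sqrt_beta_cdf m x)%:E.
Proof. by move=> m0 XE x; rewrite /cdf XE// -sqrt_le_beta_prob. Qed.

Lemma density_of_sqrt_beta m : (0 < m)%N ->
  (forall x, cdf X x = (sqrt_beta_cdf m x)%:E) ->
  has_density X (@sqrt_beta_density R m).
Proof.
move=> m0 cX; apply: has_density_of_cdf.
- exact: sqrt_beta_density_ge0.
- exact: measurable_sqrt_beta_density.
- by move=> x; rewrite cX integral_sqrt_beta_density.
Qed.

End RandomVariables.

End Cdfs.

(** * Passage to the limit *)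

Section Limits.
Variable R : realType.

(** The order of choices matters: del first, from the continuity of G at x,
    then k large enough for that del. *)
Lemma cvg_of_perturbation (F e : nat -> R) (G_ : nat -> R -> R) (G : R -> R) x :
  (forall del, 0 < del -> \forall k \near \oo,
     G_ k (x - del) - e k / del ^+ 2 <= F k <=
       G_ k (x + del) + e k / del ^+ 2) ->
  e k @[k --> \oo] --> 0 ->
  (forall y, G_ k y @[k --> \oo] --> G y) ->
  {for x, continuous G} -> F k @[k --> \oo] --> G x.
Proof.
move=> FG e0 GG cG; apply/cvgrPdist_le => eps eps0.
have eps3 : 0 < eps / 3 by rewrite divr_gt0.
move: cG => /cvgrPdist_le /(_ _ eps3) /nbhs_ballP [r r0 rG].
pose del := r / 2; have del0 : 0 < del by rewrite divr_gt0.
have Gp : `|G x - G (x + del)| <= eps / 3.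
  apply: rG; rewrite /ball /= opprD addNKr normrN gtr0_norm//.
  by rewrite ltr_pdivrMr// ltr_pMr// ltr1n.
have Gm : `|G x - G (x - del)| <= eps / 3.
  apply: rG; rewrite /ball /= opprB addrCA subrr addr0 gtr0_norm//.
  by rewrite ltr_pdivrMr// ltr_pMr// ltr1n.
have e0' : e k / del ^+ 2 @[k --> \oo] --> 0.
  by rewrite -[0](mul0r (del ^- 2)); apply: cvgM => //; exact: cvg_cst.
move/cvgrPdist_le : e0' => /(_ _ eps3) e0'.
have /cvgrPdist_le /(_ _ eps3) Hp := GG (x + del).
have /cvgrPdist_le /(_ _ eps3) Hm := GG (x - del).
near=> k.
have /andP[F1 F2] : G_ k (x - del) - e k / del ^+ 2 <= F k <=
    G_ k (x + del) + e k / del ^+ 2 by near: k; exact: FG.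
have : `|0 - e k / del ^+ 2| <= eps / 3 by near: k.
have : `|G (x + del) - G_ k (x + del)| <= eps / 3 by near: k.
have : `|G (x - del) - G_ k (x - del)| <= eps / 3 by near: k.
move: Gp Gm; rewrite !ler_norml.
move=> /andP[? ?] /andP[? ?] /andP[? ?] /andP[? ?] /andP[? ?].
by apply/andP; split; lra.
Unshelve. all: by end_near. Qed.

Lemma ler_1B_exprn (q : R) m : 0 <= q <= 1 -> 1 - m%:R * q <= (1 - q) ^+ m.
Proof.
move=> /andP[q0 q1]; elim: m => [|m IH]; first by rewrite mul0r subr0 expr0.
rewrite exprS; apply: (@le_trans _ _ ((1 - q) * (1 - m%:R * q))); last first.
  by rewrite ler_wpM2l// subr_ge0.
rewrite -subr_ge0 (_ : _ - _ = m%:R * q ^+ 2).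
  by rewrite mulr_ge0// sqr_ge0.
by rewrite -[m.+1%:R]natr1; ring.
Qed.

(** The m-th powers of exp(-a)(1 - a^2) <= 1 - a <= exp(-a), with Bernoulli's
    inequality for (1 - a^2)^m.  For a = y^2/m the relative gap is y^4/m. *)
Lemma exprn_1B_bounds (a : R) m : 0 <= a <= 1 ->
  expR (- (m%:R * a)) * (1 - m%:R * a ^+ 2) <= (1 - a) ^+ m
    <= expR (- (m%:R * a)).
Proof.
move=> /andP[a0 a1].
have eE : expR (- (m%:R * a)) = expR (- a) ^+ m.
  by rewrite -expRM_natl mulrN.
have e1 : 1 - a <= expR (- a) by rewrite expR_ge1Dx.
have e2 : expR (- a) * (1 - a ^+ 2) <= 1 - a.
  rewrite (_ : 1 - a ^+ 2 = (1 + a) * (1 - a)); last by ring.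
  rewrite mulrA ler_piMl ?subr_ge0// expRN mulrC ler_pdivrMr ?expR_gt0// mul1r.
  exact: expR_ge1Dx.
have a2 : 0 <= a ^+ 2 <= 1 by rewrite sqr_ge0 expr_le1.
have a3 : 0 <= 1 - a ^+ 2 by rewrite subr_ge0 expr_le1.
rewrite eE; apply/andP; split; last first.
  by rewrite lerXn2r ?nnegrE ?subr_ge0// expR_ge0.
apply: (@le_trans _ _ ((expR (- a) * (1 - a ^+ 2)) ^+ m)).
  by rewrite exprMn ler_wpM2l ?exprn_ge0 ?expR_ge0// ler_1B_exprn.
by rewrite lerXn2r ?nnegrE ?subr_ge0// mulr_ge0// expR_ge0.
Qed.

Lemma cvg_inv_nat : m%:R^-1 @[m --> \oo] --> (0 : R).
Proof.
rewrite gtr0_cvgV0; first exact: cvgr_idn.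
by near=> m; rewrite ltr0n; near: m; exact: nbhs_infty_gt.
Unshelve. all: by end_near. Qed.

Lemma cvg_inv_sqrtn : (Num.sqrt m%:R)^-1 @[m --> \oo] --> (0 : R).
Proof.
rewrite (_ : (fun m => _) = Num.sqrt \o (fun m => m%:R^-1)); last first.
  by apply/funext => m; rewrite /= sqrtrV.
rewrite -[X in _ --> X]sqrtr0; apply: cvg_comp cvg_inv_nat _.
exact: sqrt_continuous.
Qed.

Lemma cvg_sqrt_beta_rayleigh (y : R) :
  sqrt_beta_cdf m (y / Num.sqrt m%:R) @[m --> \oo] --> rayleigh_cdf y.
Proof.
rewrite /rayleigh_cdf; case: (leP 0 y) => y0; last first.
  rewrite (_ : (fun m => _) = cst 0); first exact: cvg_cst.
  apply/funext => m; rewrite /sqrt_beta_cdf max_l.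
    by rewrite expr0n subr0 expr1n subrr.
  by rewrite ge_min mulr_le0_ge0 ?orbT ?(ltW y0)// invr_ge0 sqrtr_ge0.
(* Once m >= y^2 + 1 the argument lies in [0, 1] and clipping is inactive. *)
have mE m : y ^+ 2 + 1 <= m%:R -> [/\ 0 < m%:R :> R, 0 <= y ^+ 2 / m%:R <= 1 &
    sqrt_beta_cdf m (y / Num.sqrt m%:R) = 1 - (1 - y ^+ 2 / m%:R) ^+ m].
  move=> ym; have m0 : 0 < m%:R :> R.
    by rewrite (lt_le_trans _ ym)// ltr_wpDl// sqr_ge0.
  have a01 : 0 <= y ^+ 2 / m%:R <= 1.
    by rewrite divr_ge0 ?sqr_ge0//= ler_pdivrMr// mul1r (le_trans _ ym)// lerDl.
  have e : (y / Num.sqrt m%:R) ^+ 2 = y ^+ 2 / m%:R.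
    by rewrite expr_div_n sqr_sqrtr.
  have b0 : 0 <= y / Num.sqrt m%:R by rewrite divr_ge0// sqrtr_ge0.
  split => //; rewrite /sqrt_beta_cdf min_r; last first.
    by rewrite -(@expr_le1 _ 2)// e; case/andP: a01.
  by rewrite max_r// e.
have big : \forall m \near \oo, y ^+ 2 + 1 <= (m%:R : R).
  exact: nbhs_infty_ger.
pose e := expR (- y ^+ 2).
apply: (@squeeze_cvgr _ _ _ _ (fun=> 1 - e)
    (fun m => 1 - e + e * y ^+ 4 * m%:R^-1)); last 2 first.
- exact: cvg_cst.
- rewrite -[X in _ --> X]addr0 -[X in _ --> _ + X](mulr0 (e * y ^+ 4)).
  apply: cvgD; first exact: cvg_cst.
  by apply: cvgM; [exact: cvg_cst|exact: cvg_inv_nat].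
near=> m; have [m0 a01 ->] : [/\ 0 < m%:R :> R, 0 <= y ^+ 2 / m%:R <= 1 &
    sqrt_beta_cdf m (y / Num.sqrt m%:R) = 1 - (1 - y ^+ 2 / m%:R) ^+ m].
  by apply: mE; near: m.
have /andP[] := exprn_1B_bounds m a01.
have -> : m%:R * (y ^+ 2 / m%:R) = y ^+ 2 by rewrite mulrC divfK// gt_eqF.
have -> : m%:R * (y ^+ 2 / m%:R) ^+ 2 = y ^+ 4 / m%:R by field; rewrite gt_eqF.
by rewrite -/e => lo hi; apply/andP; split; lra.
Unshelve. all: by end_near. Qed.

Lemma cvg_EFin_near (F : nat -> \bar R) (f : nat -> R) (l : R) :
  (\forall k \near \oo, F k = (f k)%:E) ->
  f k @[k --> \oo] --> l -> F k @[k --> \oo] --> l%:E.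
Proof.
move=> Ff fl; apply: cvg_EFin; first by near=> k; rewrite (near Ff k).
by apply: cvg_trans fl; apply: near_eq_cvg; near=> k; rewrite /= (near Ff k).
Unshelve. all: by end_near. Qed.

Lemma continuous_of_EFin (F : R -> \bar R) (G : R -> R) x :
  (forall y, F y = (G y)%:E) -> {for x, continuous F} -> {for x, continuous G}.
Proof.
move=> FG; have -> : F = EFin \o G by apply/funext.
by move=> /fine_cvg.
Qed.

End Limits.

Lemma cdf_scaled_urn (R : realType) (n m : nat) d (T : measurableType d)
    (P : probability T R) (C : nat -> T -> 'I_2) (X : {RV P >-> R}) (c x : R) :
  urn_draws P urnM (urn_init n (2 * m)) C ->
  final_white urnM (urn_init n (2 * m)) C X -> 0 < c ->
  cdf (c^-1 *: (X : {mfun T >-> R}) : {RV P >-> R}) x =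
    (mix_cdf n m (c * x))%:E.
Proof.
move=> drawsC finalX c0; rewrite -(urn_law drawsC finalX) /cdf /distribution.
rewrite /pushforward; congr (P _); apply/seteqP.
by split => w; rewrite /= in_itv /= /GRing.scale/= ler_pdivrMl.
Qed.

Theorem theorem3 (R : realType)
    (d : nat -> nat -> measure_display)
    (T : forall n m : nat, measurableType (d n m))
    (P : forall n m : nat, probability (T n m) R)
    (C : forall n m : nat, nat -> T n m -> 'I_2)
    (X : forall n m : nat, {RV (P n m) >-> R})
    (hC : forall n m : nat, (1 <= m)%N ->
      urn_draws (P n m) urnM (urn_init n (2 * m)) (C n m))
    (hX : forall n m : nat, (1 <= m)%N ->
      final_white urnM (urn_init n (2 * m)) (C n m) (X n m)) :
  (forall (n : nat -> nat)
      (d' : measure_display) (T' : measurableType d') (Q : probability T' R)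
      (Ray : {RV Q >-> R}),
    has_density Ray (@rayleigh_density R) ->
    cvg_in_distribution
      (fun m : nat =>
         ((n m)%:R / Num.sqrt m%:R + 2 * Num.sqrt m%:R)^-1
           *: (X (n m) m : {mfun T (n m) m >-> R})
         : {RV (P (n m) m) >-> R})
      Ray)
  /\
  (forall (m : nat), (1 <= m)%N -> forall
      (d' : measure_display) (T' : measurableType d') (Q : probability T' R)
      (B : {RV Q >-> R}),
    (forall A : set R, measurable A ->
       distribution Q B A = pushforward (beta_prob 1 m) (@Num.sqrt R) A) ->
    has_density B (@sqrt_beta_density R m) /\
    cvg_in_distribution
      (fun n : nat =>
         (n%:R)^-1 *: (X n m : {mfun T n m >-> R}) : {RV (P n m) >-> R}) B).
Proof.
split=> [n d' T' Q Ray dRay x cx|m m0 d' T' Q B BE].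
- have cE := cdf_of_rayleigh dRay; rewrite cE.
  apply: (cvg_EFin_near (f := fun m =>
      mix_cdf (n m) m (((n m)%:R / Num.sqrt m%:R + 2 * Num.sqrt m%:R) * x))).
    near=> m; have m0 : (0 < m)%N by near: m; exact: nbhs_infty_gt.
    apply: cdf_scaled_urn (hC _ _ m0) (hX _ _ m0) _.
    by rewrite ltr_wpDl ?divr_ge0 ?sqrtr_ge0// mulr_gt0// sqrtr_gt0 ltr0n.
  apply: (cvg_of_perturbation (e := fun m => 5 / Num.sqrt m%:R)
    (G_ := fun m y => sqrt_beta_cdf m (y / Num.sqrt m%:R))).
  + move=> del del0; near=> m; apply: mix_cdf_bounds_grow => //.
    by near: m; exact: nbhs_infty_gt.
  + rewrite -[0](mulr0 5).
    by apply: cvgM; [exact: cvg_cst|exact: cvg_inv_sqrtn].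
  + exact: cvg_sqrt_beta_rayleigh.
  + exact: continuous_of_EFin cE cx.
- have cE := cdf_of_sqrt_beta m0 BE.
  split; first exact: density_of_sqrt_beta.
  move=> x cx; rewrite cE.
  apply: (cvg_EFin_near (f := fun n => mix_cdf n m (n%:R * x))).
    near=> n; have n0 : (0 < n)%N by near: n; exact: nbhs_infty_gt.
    by apply: cdf_scaled_urn (hC _ _ m0) (hX _ _ m0) _; rewrite ltr0n.
  apply: (cvg_of_perturbation (e := fun n => (1 + m%:R + m%:R ^+ 2) / n%:R)
    (G_ := fun _ => @sqrt_beta_cdf R m)).
  + move=> del del0; near=> n; apply: mix_cdf_bounds_fixed => //.
    by near: n; exact: nbhs_infty_gt.
  + rewrite -[0](mulr0 (1 + m%:R + m%:R ^+ 2)).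
    by apply: cvgM; [exact: cvg_cst|exact: cvg_inv_nat].
  + by move=> y; exact: cvg_cst.
  + exact: continuous_of_EFin cE cx.
Unshelve. all: by end_near. Qed.
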